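(* Let $n,m,T\ge1$, let $C\in\mathbb{R}^{1\times n}$ be known, and let the data $(U_-,W_-,X)$ be generated by the Lur'e system $x(t+1)=A_sx(t)+B_su(t)+E_s\phi(Cx(t))$, $t=0,\dots,T-1$, where $A_s\in\mathbb{R}^{n\times n}$, $B_s\in\mathbb{R}^{n\times m}$, $E_s\in\mathbb{R}^{n\times 1}$ and $\phi:\mathbb{R}\to\mathbb{R}$ satisfies the sector condition $\phi(y)(\phi(y)-y)\le0$ for all $y\in\mathbb{R}$. Then the data $(U_-,W_-,X)$ are informative for absolute quadratic stabilization if and only if there exist matrices $Q=Q^\top\in\mathbb{R}^{n\times n}$ with $Q>0$ and $L\in\mathbb{R}^{m\times n}$ and scalars $\alpha\in\mathbb{R}$ and $\beta>0$ such that $CQC^\top<4$ and $$\begin{bmatrix} Q-\beta I & 0 & 0 & 0 & 0 & 0\\ 0&0&0&0&Q&0\\ 0&0&0&0&L&0\\ 0&0&0&0&0&1\\ 0&Q&L^\top&0&Q&-\tfrac12QC^\top\\ 0&0&0&1&-\tfrac12CQ&1\end{bmatrix}+\alpha\begin{bmatrix} X_+\\-X_-\\-U_-\\-W_-\\0\\0\end{bmatrix}\begin{bmatrix} X_+\\-X_-\\-U_-\\-W_-\\0\\0\end{bmatrix}^\top\ge0.$$ In this case (i.e. for any such $Q,L,\alpha,\beta$), $K:=LQ^{-1}$ is such that the closed-loop system $x(t+1)=(A+BK)x(t)+E\phi(Cx(t))$ is absolutely stable for all $(A,B,E)\in\Sigma$.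
   Context: Data matrices: given states $x(0),\dots,x(T)\in\mathbb{R}^n$ and inputs $u(0),\dots,u(T-1)\in\mathbb{R}^m$, $X=[x(0)\ \cdots\ x(T)]$, $X_-=[x(0)\ \cdots\ x(T-1)]$, $X_+=[x(1)\ \cdots\ x(T)]$, $U_-=[u(0)\ \cdots\ u(T-1)]$, and $W_-=[\phi(Cx(0))\ \ \phi(Cx(1))\ \cdots\ \phi(Cx(T-1))]\in\mathbb{R}^{1\times T}$. Thus $X_+=A_sX_-+B_sU_-+E_sW_-$. The set of systems explaining the data is $\Sigma:=\{(A,B,E)\in\mathbb{R}^{n\times n}\times\mathbb{R}^{n\times m}\times\mathbb{R}^{n\times1}\mid X_+=AX_-+BU_-+EW_-\}$. The data $(U_-,W_-,X)$ are called informative for absolute quadratic stabilization if there exist $P=P^\top\in\mathbb{R}^{n\times n}$ with $P>0$ and $K\in\mathbb{R}^{m\times n}$ such that, for all $(A,B,E)\in\Sigma$, with $A_K:=A+BK$, $$\begin{bmatrix} P-A_K^\top PA_K & -A_K^\top PE-\tfrac12C^\top\\ -E^\top PA_K-\tfrac12C & 1-E^\top PE\end{bmatrix}>0.$$ The closed-loop system $x(t+1)=(A+BK)x(t)+E\phi(Cx(t))$ is called absolutely stable if the origin is globally asymptotically stable for every function $\phi:\mathbb{R}\to\mathbb{R}$ satisfying $\phi(y)(\phi(y)-y)\le0$ for all $y\in\mathbb{R}$. For a real symmetric matrix $S$, $S>0$ ($S\ge0$) means positive definite (positive semidefinite). The blocks in the $6\times 6$ block matrix inequality have sizes $n,n,m,1,n,1$.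 *)

(* Defs.v *)
From HB Require Import structures.
From mathcomp Require Import all_boot all_order all_algebra.
From mathcomp Require Import all_classical all_reals all_analysis.

Set Implicit Arguments.
Unset Strict Implicit.
Unset Printing Implicit Defensive.

Import Order.TTheory GRing.Theory Num.Theory.
Import numFieldNormedType.Exports.

Local Open Scope classical_set_scope.
Local Open Scope ring_scope.

(* Symmetry is part of both definiteness predicates. *)
Definition posdefmx (R : realType) (n : nat) (S : 'M[R]_n) : Prop :=
  S^T = S /\ forall v : 'cV[R]_n, v != 0 -> 0 < (v^T *m S *m v) 0 0.

Definition possemidefmx (R : realType) (n : nat) (S : 'M[R]_n) : Prop :=
  S^T = S /\ forall v : 'cV[R]_n, 0 <= (v^T *m S *m v) 0 0.

Definition sector (R : realType) (phi : R -> R) : Prop :=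
  forall y : R, phi y * (phi y - y) <= 0.

(* [ s 0 ... s (k-1) ] *)
Definition columns (R : realType) (n k : nat) (s : nat -> 'cV[R]_n) :
    'M[R]_(n, k) :=
  \matrix_(i < n, t < k) s t i 0.

Definition Xminus (R : realType) (n T : nat) (X : 'M[R]_(n, T.+1)) :
    'M[R]_(n, T) :=
  colsub (widen_ord (leqnSn T)) X.

Definition Xplus (R : realType) (n T : nat) (X : 'M[R]_(n, T.+1)) :
    'M[R]_(n, T) :=
  colsub (lift ord0) X.

(* The systems explaining the data (U, W, X), with U and W standing for
   U_- and W_-. *)
Definition Sigma (R : realType) (n m T : nat)
    (U : 'M[R]_(m, T)) (W : 'rV[R]_T) (X : 'M[R]_(n, T.+1)) :
    set ('M[R]_n * 'M[R]_(n, m) * 'cV[R]_n) :=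
  [set S | let: (A, B, E) := S in
           Xplus X = A *m Xminus X + B *m U + E *m W].

Definition informative_abs_quad_stab (R : realType) (n m T : nat)
    (C : 'rV[R]_n)
    (U : 'M[R]_(m, T)) (W : 'rV[R]_T) (X : 'M[R]_(n, T.+1)) : Prop :=
  exists (P : 'M[R]_n) (K : 'M[R]_(m, n)),
    posdefmx P /\
    forall (A : 'M[R]_n) (B : 'M[R]_(n, m)) (E : 'cV[R]_n),
      Sigma U W X (A, B, E) ->
      let AK := A + B *m K in
      posdefmx
        (block_mx (P - AK^T *m P *m AK) (- (AK^T *m P *m E) - 2^-1 *: C^T)
                  (- (E^T *m P *m AK) - 2^-1 *: C) (1%:M - E^T *m P *m E)).

Definition lyapunov_stable (R : realType) (n : nat)
    (f : 'cV[R]_n -> 'cV[R]_n) : Prop :=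
  forall e : R, 0 < e -> exists2 d : R, 0 < d &
    forall x0 : 'cV[R]_n, `|x0| < d -> forall t : nat, `|iter t f x0| < e.

Definition globally_attractive (R : realType) (n : nat)
    (f : 'cV[R]_n -> 'cV[R]_n) : Prop :=
  forall x0 : 'cV[R]_n, iter t f x0 @[t --> \oo] --> (0 : 'cV[R]_n).

(* Global asymptotic stability of the origin for x(t+1) = f(x(t)).  The norm
   on 'cV[R]_n is the sup norm, which is equivalent to the Euclidean one. *)
Definition gas (R : realType) (n : nat) (f : 'cV[R]_n -> 'cV[R]_n) : Prop :=
  lyapunov_stable f /\ globally_attractive f.

(* Absolute stability of x(t+1) = M x(t) + E phi(C x(t)). *)
Definition absolutely_stable (R : realType) (n : nat)
    (C : 'rV[R]_n) (M : 'M[R]_n) (E : 'cV[R]_n) : Prop :=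
  forall phi : R -> R, sector phi ->
    gas (fun x : 'cV[R]_n => M *m x + phi ((C *m x) 0 0) *: E).

(* The block rows and columns of the next two matrices have sizes
   n, n, m, 1, n, 1. *)
Definition lmi_mx (R : realType) (n m : nat) (C : 'rV[R]_n)
    (Q : 'M[R]_n) (L : 'M[R]_(m, n)) (beta : R) :
    'M[R]_(n + (n + (m + (1 + (n + 1))))) :=
  col_mx (row_mx (Q - beta%:M)
           (row_mx 0 (row_mx 0 (row_mx 0 (row_mx 0 0)))))
 (col_mx (row_mx 0 (row_mx 0 (row_mx 0 (row_mx 0 (row_mx Q 0)))))
 (col_mx (row_mx 0 (row_mx 0 (row_mx 0 (row_mx 0 (row_mx L 0)))))
 (col_mx (row_mx 0 (row_mx 0 (row_mx 0 (row_mx 0 (row_mx 0 1%:M)))))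
 (col_mx (row_mx 0 (row_mx Q (row_mx L^T (row_mx 0
           (row_mx Q (- (2^-1 *: (Q *m C^T))))))))
         (row_mx 0 (row_mx 0 (row_mx 0 (row_mx 1%:M
           (row_mx (- (2^-1 *: (C *m Q))) 1%:M))))))))).

Definition data_mx (R : realType) (n m T : nat)
    (U : 'M[R]_(m, T)) (W : 'rV[R]_T) (X : 'M[R]_(n, T.+1)) :
    'M[R]_(n + (n + (m + (1 + (n + 1)))), T) :=
  col_mx (Xplus X)
 (col_mx (- Xminus X)
 (col_mx (- U)
 (col_mx (- W)
 (col_mx 0 0)))).

Definition lmi_solution (R : realType) (n m T : nat) (C : 'rV[R]_n)
    (U : 'M[R]_(m, T)) (W : 'rV[R]_T) (X : 'M[R]_(n, T.+1))
    (Q : 'M[R]_n) (L : 'M[R]_(m, n)) (alpha beta : R) : Prop :=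
  [/\ posdefmx Q,
      0 < beta,
      (C *m Q *m C^T) 0 0 < 4 &
      possemidefmx (lmi_mx C Q L beta
                    + alpha *: (data_mx U W X *m (data_mx U W X)^T))].

(* Main.v *)
(* Put Z = [A B E], D = [X_-; U_-; W_-], so that Sigma is the affine space
   Z D = X_+. With Q = P^-1 and L = K Q, a congruence turns the stability
   inequality at Z into N - (Z F)^T Q^-1 (Z F) > 0, where
   F = [Q 0; L 0; 0 1] and N = [Q, -Q C^T/2; -C Q/2, 1]; and N > 0 iff
   C Q C^T < 4. The LMI says that a quadratic form in (v, w, h) is nonnegative,
   and its alpha-term is |X_+^T v - D^T w|^2. Restricting to w = Z^T v gives
   the sufficiency. Conversely, Sigma is invariant under translations that
   kill D, so the inequality can hold on all of Sigma only if ker D^T is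
   contained in ker F^T; then F^T factors through D^T and completing squares
   yields alpha and beta. Absolute stability follows from the Lyapunov function
   x^T P x and the S-procedure. *)
Require Import Defs.
From mathcomp Require Import all_boot all_order all_algebra.
From mathcomp Require Import all_classical all_reals all_analysis.
From mathcomp Require Import ring lra.

Import Order.TTheory GRing.Theory Num.Theory.
Import numFieldNormedType.Exports.

Local Open Scope ring_scope.

Set Implicit Arguments.
Unset Strict Implicit.
Unset Printing Implicit Defensive.

(** * Inner products, positive definite matrices and bounds on quadratic forms *)

Section Dot.
Variable R : realType.

Definition dot n (u v : 'cV[R]_n) : R := (u^T *m v) 0 0.

Lemma dotE n (u v : 'cV[R]_n) : dot u v = \sum_i u i 0 * v i 0.
Proof. by rewrite /dot mxE; apply: eq_bigr => i _; rewrite mxE. Qed.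

Lemma dotC n (u v : 'cV[R]_n) : dot u v = dot v u.
Proof. by rewrite !dotE; apply: eq_bigr => i _; rewrite mulrC. Qed.

Lemma dotDr n (u v w : 'cV[R]_n) : dot u (v + w) = dot u v + dot u w.
Proof. by rewrite /dot mulmxDr mxE. Qed.

Lemma dotDl n (u v w : 'cV[R]_n) : dot (v + w) u = dot v u + dot w u.
Proof. by rewrite dotC dotDr !(dotC u). Qed.

Lemma dotZr n a (u v : 'cV[R]_n) : dot u (a *: v) = a * dot u v.
Proof. by rewrite /dot -scalemxAr mxE. Qed.

Lemma dotZl n a (u v : 'cV[R]_n) : dot (a *: v) u = a * dot v u.
Proof. by rewrite dotC dotZr dotC. Qed.

Lemma dotNr n (u v : 'cV[R]_n) : dot u (- v) = - dot u v.
Proof. by rewrite -scaleN1r dotZr mulN1r. Qed.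

Lemma dotNl n (u v : 'cV[R]_n) : dot (- v) u = - dot v u.
Proof. by rewrite dotC dotNr dotC. Qed.

Lemma dot0r n (u : 'cV[R]_n) : dot u 0 = 0.
Proof. by rewrite /dot mulmx0 mxE. Qed.

Definition dot_linE := (dotDr, dotDl, dotNr, dotNl, dotZr, dotZl).

Lemma dot_mulmxl m n (M : 'M[R]_(m, n)) u v : dot (M *m u) v = dot u (M^T *m v).
Proof. by rewrite /dot trmx_mul mulmxA. Qed.

Lemma dot_mulmxr m n (M : 'M[R]_(m, n)) u v : dot u (M *m v) = dot (M^T *m u) v.
Proof. by rewrite dot_mulmxl trmxK. Qed.

Lemma dot_sym n (S : 'M[R]_n) u v : S^T = S -> dot u (S *m v) = dot v (S *m u).
Proof. by move=> symS; rewrite dot_mulmxr symS dotC. Qed.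

Lemma dot_col_mx m n (a c : 'cV[R]_m) (b d : 'cV[R]_n) :
  dot (col_mx a b) (col_mx c d) = dot a c + dot b d.
Proof. by rewrite /dot tr_col_mx mul_row_col mxE. Qed.

Lemma quad_dot n (S : 'M[R]_n) v : (v^T *m S *m v) 0 0 = dot v (S *m v).
Proof. by rewrite /dot mulmxA. Qed.

Lemma dot_ge0 n (v : 'cV[R]_n) : 0 <= dot v v.
Proof. by rewrite dotE sumr_ge0 // => i _; rewrite -expr2 sqr_ge0. Qed.

Lemma sqr_coord_le_dot n (v : 'cV[R]_n) i : v i 0 ^+ 2 <= dot v v.
Proof.
rewrite dotE (bigD1 i) //= expr2 lerDl sumr_ge0 // => j _.
by rewrite -expr2 sqr_ge0.
Qed.

Lemma dot_gt0 n (v : 'cV[R]_n) : v != 0 -> 0 < dot v v.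
Proof.
move=> v0; rewrite lt_def dot_ge0 andbT; apply: contra v0 => /eqP v0.
apply/eqP/colP => i; rewrite mxE; apply/eqP; rewrite -sqrf_eq0.
by rewrite eq_le sqr_ge0 andbT -v0 sqr_coord_le_dot.
Qed.

Lemma mx_sym_dot n (S : 'M[R]_n) :
  (forall u v, dot u (S *m v) = dot v (S *m u)) -> S^T = S.
Proof.
move=> symS; apply/matrixP => i j.
have E k l : S k l = dot (delta_mx k 0) (S *m delta_mx l 0).
  by rewrite /dot mulmxA trmx_delta -rowE -colE !mxE.
by rewrite mxE !E symS.
Qed.

Lemma quad_upper n (S : 'M[R]_n) :
  exists2 c : R, 0 < c & forall v, dot v (S *m v) <= c * dot v v.
Proof.
(* The summand 1 only makes the constant positive; the rest is [|v_i v_j| <= (v_i^2 + v_j^2) / 2 <=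
   |v|^2]. *)
exists (1 + \sum_i \sum_j `|S i j|).
  by rewrite ltr_pwDl // sumr_ge0 // => i _; rewrite sumr_ge0.
move=> v; rewrite mulrDl mul1r.
apply: (@le_trans _ _ ((\sum_i \sum_j `|S i j|) * dot v v)); last first.
  by rewrite lerDr dot_ge0.
rewrite {1}dotE mulr_suml; apply: ler_sum => i _.
rewrite mxE mulr_sumr mulr_suml; apply: ler_sum => j _.
apply: le_trans (ler_norm _) _; rewrite mulrCA normrM.
apply: ler_wpM2l => //; rewrite normrM.
have := sqr_coord_le_dot v i; have := sqr_coord_le_dot v j.
rewrite -(real_normK (num_real (v i 0))) -(real_normK (num_real (v j 0))).
have := sqr_ge0 (`|v i 0| - `|v j 0|); nra.
Qed.

Lemma mulmx_dot_upper m n (M : 'M[R]_(m, n)) :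
  exists2 c : R, 0 < c & forall v, dot (M *m v) (M *m v) <= c * dot v v.
Proof.
have [c c0 cP] := quad_upper (M^T *m M).
by exists c => // v; rewrite dot_mulmxl mulmxA.
Qed.

Lemma posdefmxP n (S : 'M[R]_n) :
  posdefmx S <->
  S^T = S /\ forall v : 'cV[R]_n, v != 0 -> 0 < dot v (S *m v).
Proof.
by split=> -[symS posS]; split=> // v /posS; rewrite quad_dot.
Qed.

Lemma posdef_sym n (S : 'M[R]_n) : posdefmx S -> S^T = S.
Proof. by case. Qed.

Lemma posdef_gt0 n (S : 'M[R]_n) v : posdefmx S -> v != 0 -> 0 < dot v (S *m v).
Proof. by case/posdefmxP => _; apply. Qed.

Lemma posdef_ge0 n (S : 'M[R]_n) v : posdefmx S -> 0 <= dot v (S *m v).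
Proof.
move=> posS; have [->|v0] := eqVneq v 0; first by rewrite mulmx0 dot0r.
exact/ltW/posdef_gt0.
Qed.

Lemma posdef_unit n (S : 'M[R]_n) : posdefmx S -> S \in unitmx.
Proof.
move=> posS; rewrite -row_free_unit -kermx_eq0; apply/rowV0P.
move=> v /sub_kermxP vS.
apply/eqP/negPn/negP => v0; have v0' : v^T != 0 by rewrite trmx_eq0.
have := posdef_gt0 posS v0'.
by rewrite -[in S *m _](posdef_sym posS) -trmx_mul vS trmx0 dot0r ltxx.
Qed.

Lemma posdef_inv n (S : 'M[R]_n) : posdefmx S -> posdefmx (invmx S).
Proof.
move=> posS; have uS := posdef_unit posS; apply/posdefmxP; split.
  by rewrite trmx_inv (posdef_sym posS).
move=> v v0; have w0 : invmx S *m v != 0.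
  by apply: contra v0 => /eqP w0; rewrite -(mulKVmx uS v) w0 mulmx0.
by have := posdef_gt0 posS w0; rewrite mulKVmx // dotC.
Qed.

(* Expand [0 <= dot (v - t *: b) (S *m (v - t *: b))] with [b = S^-1 v] and
   [t] the inverse of an upper bound of [S^-1]. *)
Lemma posdef_lower n (S : 'M[R]_n) : posdefmx S ->
  exists2 c : R, 0 < c & forall v, c * dot v v <= dot v (S *m v).
Proof.
move=> posS; have uS := posdef_unit posS.
have [c c0 cP] := quad_upper (invmx S).
exists c^-1; first by rewrite invr_gt0.
move=> v; have := posdef_ge0 (v - c^-1 *: (invmx S *m v)) posS.
have E : dot (invmx S *m v) (S *m v) = dot v v.
  by rewrite dot_mulmxl (posdef_sym (posdef_inv posS)) mulKmx.
rewrite mulmxBr -scalemxAr mulKVmx // !dot_linE E (dotC (invmx S *m v)).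
have c0' : 0 < c^-1 * c^-1 by rewrite mulr_gt0 ?invr_gt0.
have := ler_wpM2l (ltW c0') (cP v); rewrite [leRHS]mulrA divfK ?gt_eqF //.
move: (c^-1) => d; nra.
Qed.

End Dot.

(** * A Finsler-type lemma over the affine space [Z D = Y] *)

Lemma col_inj0 (R : realType) m n (A : 'M[R]_(m, n)) :
  (forall j, col j A = 0) -> A = 0.
Proof.
by move=> A0; apply/matrixP => i j; move/colP/(_ i): (A0 j); rewrite !mxE.
Qed.

Lemma dot_subr_le (R : realType) n (u v : 'cV[R]_n) :
  dot (u - v) (u - v) <= 2 * dot u u + 2 * dot v v.
Proof. by have := dot_ge0 (u + v); rewrite !dot_linE (dotC v u); lra. Qed.

Section Finsler.
Variables (R : realType) (n p q T : nat).
Variables (Q : 'M[R]_n) (N : 'M[R]_q) (F : 'M[R]_(p, q)) (D : 'M[R]_(p, T)).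
Hypothesis posQ : posdefmx Q.

(** The quadratic form of the LMI, where [w] merges the three middle blocks and [h] the last two. *)
Definition finsler_form (Y : 'M[R]_(n, T)) (alpha beta : R)
    (v : 'cV[R]_n) (w : 'cV[R]_p) (h : 'cV[R]_q) : R :=
  dot v (Q *m v) - beta * dot v v + 2 * dot w (F *m h) + dot h (N *m h)
  + alpha * dot (Y^T *m v - D^T *m w) (Y^T *m v - D^T *m w).

(* Evaluate the form at [w = Z^T v], where the [alpha] term vanishes, and at
   [v = - Q^-1 Z F h], the minimizer of [v |-> v^T Q v + 2 v^T Z F h]. *)
Lemma finsler_sufficient (Y : 'M[R]_(n, T)) alpha beta (Z : 'M[R]_(n, p)) h :
  posdefmx N -> 0 < beta ->
  (forall v w h, 0 <= finsler_form Y alpha beta v w h) ->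
  Z *m D = Y -> h != 0 ->
  dot (Z *m F *m h) (invmx Q *m (Z *m F *m h)) < dot h (N *m h).
Proof.
move=> posN beta0 form_ge0 ZD h0; set g := Z *m F *m h.
(* For [g = 0] strictness comes from [N > 0]; otherwise it comes from the term [beta |v|^2]. *)
have [->|g0] := eqVneq g 0; first by rewrite mulmx0 dot0r posdef_gt0.
pose v := invmx Q *m g.
have v0 : v != 0.
  apply: contra g0 => /eqP v0.
  by rewrite -(mulKVmx (posdef_unit posQ) g) -/v v0 mulmx0.
have := form_ge0 (- v) (Z^T *m - v) h.
rewrite /finsler_form mulmxA -trmx_mul ZD subrr dot0r mulr0 addr0.
rewrite dot_mulmxl trmxK mulmxN !dot_linE.
rewrite {2}/v mulKVmx ?posdef_unit // mulmxA -/g (dotC v g).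
have := dot_gt0 v0; nra.
Qed.

Section Necessary.
Variables (P : 'M[R]_n) (Z0 : 'M[R]_(n, p)).
Hypothesis QP : Q *m P = 1%:M.
Hypothesis stable : forall Z : 'M[R]_(n, p), Z *m D = Z0 *m D ->
  forall h, h != 0 -> dot (Z *m F *m h) (P *m (Z *m F *m h)) < dot h (N *m h).

Let posP : posdefmx P.
Proof.
suff -> : P = invmx Q by exact: posdef_inv.
by rewrite -[LHS](mulKmx (posdef_unit posQ)) QP mulmx1.
Qed.

(* If [D^T s = 0] but [h^T F^T s != 0], perturbing [Z0] by a multiple of
   [v s^T] keeps [Z D] fixed and makes [Z F h] an arbitrary vector. *)
Lemma finsler_kernel (s : 'cV[R]_p) : (0 < n)%N -> D^T *m s = 0 -> F^T *m s = 0.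
Proof.
move=> n0 Ds; apply/eqP/negPn/negP => Fs.
pose h := F^T *m s; pose a := dot s (F *m h).
have a_neq0 : a != 0 by rewrite /a dot_mulmxr gt_eqF // dot_gt0.
pose e : 'cV[R]_n := const_mx 1.
have e0 : e != 0.
  apply/eqP => /colP/(_ (Ordinal n0)); rewrite !mxE => /eqP.
  by rewrite oner_eq0.
have Pe := posdef_gt0 posP e0.
(* As [k >= 1], [k^2 e^T P e >= k e^T P e >= |h^T N h|], which contradicts [stable] once
   [Z F h = k e]. *)
pose k := 1 + `|dot h (N *m h)| / dot e (P *m e).
pose Z := Z0 + (a^-1 *: (k *: e - Z0 *m F *m h)) *m s^T.
have ZD : Z *m D = Z0 *m D.
  rewrite mulmxDl -(mulmxA _ s^T) -[s^T *m D]trmxK trmx_mul trmxK Ds.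
  by rewrite trmx0 mulmx0 addr0.
have sFh : s^T *m (F *m h) = a%:M.
  by rewrite [LHS]mx11_scalar.
have ZFh : Z *m F *m h = k *: e.
  rewrite -(mulmxA Z) mulmxDl -(mulmxA _ s^T) sFh mul_mx_scalar.
  by rewrite scalerA divff // scale1r addrC mulmxA subrK.
have := stable ZD Fs; rewrite -/h ZFh -scalemxAr !dot_linE.
rewrite ltNge => /negP; apply.
have b0 : 0 <= `|dot h (N *m h)| / dot e (P *m e).
  by rewrite divr_ge0 // ltW.
apply: le_trans (ler_norm _) _.
rewrite -{1}(divfK (lt0r_neq0 Pe) `|dot h (N *m h)|) mulrA.
apply: ler_wpM2r; first exact: ltW.
rewrite /k; nra.
Qed.

(* With [w = Z0^T v + s] and [r = v + P Z0 F h] the form becomes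
   [r^T Q r + h^T J h - beta |v|^2 + 2 s^T F h + alpha |D^T s|^2], where
   [J = N - F^T Z0^T P Z0 F > 0] and [F^T s] is a function of [D^T s]. *)
Lemma finsler_necessary : (0 < n)%N -> N^T = N ->
  exists alpha beta : R, 0 < beta /\
    forall v w h, 0 <= finsler_form (Z0 *m D) alpha beta v w h.
Proof.
move=> n0 symN.
pose G := P *m (Z0 *m F).
pose J := N - (Z0 *m F)^T *m G.
have JE h : dot h (J *m h) =
    dot h (N *m h) - dot (Z0 *m F *m h) (P *m (Z0 *m F *m h)).
  rewrite mulmxBl !dot_linE -(mulmxA _ G) [dot h (_^T *m _)]dot_mulmxr trmxK.
  by rewrite /G !mulmxA.
have posJ : posdefmx J.
  apply/posdefmxP; split.
    by rewrite /J /G linearB /= symN !trmx_mul !trmxK (posdef_sym posP) !mulmxA.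
  by move=> h h0; rewrite JE subr_gt0 stable.
(* The columns of the cokernel matrix of [D^T] are killed by [D^T], hence by [F^T], and this is the
   criterion for row space inclusion. *)
have [S FS] : exists S, F^T = S *m D^T.
  apply/submxP; rewrite submxE; apply/eqP/col_inj0 => j.
  rewrite colE -mulmxA finsler_kernel // mulmxA mulmx_coker mul0mx //.
have [c1 c1_gt0 Q_lower] := posdef_lower posQ.
have [c2 c2_gt0 J_lower] := posdef_lower posJ.
have [c3 c3_gt0 G_upper] := mulmx_dot_upper G.
have [c4 c4_gt0 S_upper] := mulmx_dot_upper S.
(* From [|v|^2 <= 2 |r|^2 + 2 c3 |h|^2], this choice gives
   [beta |v|^2 <= c1 |r|^2 + (c2 / 2) |h|^2], absorbed by [r^T Q r] and half of the lower bound of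
   [h^T J h]. *)
pose beta := Num.min (c1 / 2) (c2 / (4 * c3)).
have beta_gt0 : 0 < beta by rewrite lt_min !divr_gt0 // mulr_gt0.
have beta_c1 : beta * 2 <= c1 by rewrite -ler_pdivlMr // ge_min lexx.
have beta_c3 : beta * (4 * c3) <= c2.
  by rewrite -ler_pdivlMr ?mulr_gt0 // ge_min lexx orbT.
(* The other half, [k |h|^2], together with [alpha |d|^2] dominates the cross term [2 (S d)^T h], by
   expanding [|k h + S d|^2 >= 0]. *)
pose k := c2 / 2; have k_gt0 : 0 < k by rewrite divr_gt0.
exists (c4 / k), beta; split=> // v w h.
pose s := w - Z0^T *m v; pose d := D^T *m s; pose g := Z0 *m F *m h.
pose r := v + G *m h.
have GhE : G *m h = P *m g by rewrite /G /g !mulmxA.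
have dE : (Z0 *m D)^T *m v - D^T *m w = - d.
  by rewrite /d /s mulmxBr trmx_mul !mulmxA opprB.
have wE : dot w (F *m h) = dot v g + dot (S *m d) h.
  have -> : w = s + Z0^T *m v by rewrite subrK.
  rewrite dotDl dot_mulmxl trmxK [Z0 *m _]mulmxA addrC; congr (_ + _).
  by rewrite dot_mulmxr FS -mulmxA.
have hE : dot h (N *m h) = dot h (J *m h) + dot g (P *m g).
  by rewrite JE subrK.
have rE : dot r (Q *m r) = dot v (Q *m v) + 2 * dot v g + dot g (P *m g).
  rewrite /r GhE mulmxDr [Q *m (P *m _)]mulmxA QP mul1mx !dot_linE.
  rewrite [dot (P *m g) (Q *m v)]dot_mulmxr posdef_sym // mulmxA QP mul1mx.
  by rewrite (dotC g v) (dotC (P *m g) g); ring.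
have vE : dot v v <= 2 * dot r r + 2 * (c3 * dot h h).
  have := G_upper h; have := dot_subr_le r (G *m h); rewrite addrK; lra.
have kE : 0 <= k * dot h h + 2 * dot (S *m d) h + c4 / k * dot d d.
  have := dot_ge0 (k *: h + S *m d); rewrite !dot_linE (dotC h) => sq_ge0.
  have ckE : k * (c4 / k) = c4 by rewrite mulrC divfK // gt_eqF.
  rewrite -(pmulr_rge0 _ k_gt0) !mulrDr [k * (c4 / k * _)]mulrA ckE.
  have := S_upper d; lra.
rewrite /finsler_form dE wE hE dotNl dotNr opprK.
have := Q_lower r; have := J_lower h; rewrite rE.
have := ler_wpM2l (ltW beta_gt0) vE.
have := ler_wpM2r (dot_ge0 r) beta_c1; have := ler_wpM2r (dot_ge0 h) beta_c3.
move: kE; rewrite /k; lra.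
Qed.

End Necessary.
End Finsler.

(** * The block matrices of the problem and their quadratic forms *)

Section TrmxLinear.
Variables (R : realType) (m n : nat).
Implicit Types A B : 'M[R]_(m, n).

Lemma trmxN A : (- A)^T = - A^T.
Proof. exact: linearN. Qed.

Lemma trmxB A B : (A - B)^T = A^T - B^T.
Proof. exact: linearB. Qed.

Lemma trmxZ (a : R) A : (a *: A)^T = a *: A^T.
Proof. exact: linearZ. Qed.
End TrmxLinear.

(** Symmetry is checked on the bilinear form, with both vectors split into their six blocks, instead
    of transposing the nested blocks. *)
Lemma lmi_mx_sym (R : realType) (n m : nat) (C : 'rV[R]_n) (Q : 'M[R]_n)
    (L : 'M[R]_(m, n)) beta :
  Q^T = Q -> (lmi_mx C Q L beta)^T = lmi_mx C Q L beta.
Proof.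
move=> symQ; apply: mx_sym_dot => u v.
rewrite -(vsubmxK u) -(vsubmxK (dsubmx u)) -(vsubmxK v) -(vsubmxK (dsubmx v)).
move: (usubmx u) (usubmx v) (usubmx (dsubmx u)) (usubmx (dsubmx v)).
move: (dsubmx (dsubmx u)) (dsubmx (dsubmx v)) => {}u {}v u0 v0 u1 v1.
rewrite -(vsubmxK u) -(vsubmxK (dsubmx u)) -(vsubmxK v) -(vsubmxK (dsubmx v)).
move: (usubmx u) (usubmx v) (usubmx (dsubmx u)) (usubmx (dsubmx v)).
move: (dsubmx (dsubmx u)) (dsubmx (dsubmx v)) => {}u {}v u2 v2 u3 v3.
rewrite -(vsubmxK u) -(vsubmxK v).
move: (usubmx u) (usubmx v) (dsubmx u) (dsubmx v) => {u v} u4 v4 u5 v5.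
rewrite /lmi_mx !mul_col_mx !mul_row_col !mul0mx !mul1mx !addr0 !add0r.
rewrite !dot_col_mx !mulmxBl !mul_scalar_mx !mulNmx -!scalemxAl !dot_linE.
have QC (a : 'cV_n) (b : 'cV_1) : dot a (Q *m C^T *m b) = dot b (C *m Q *m a).
  by rewrite dot_mulmxr trmx_mul trmxK symQ dotC.
have LE (a : 'cV_n) (b : 'cV_m) : dot a (L^T *m b) = dot b (L *m a).
  by rewrite dot_mulmxr trmxK dotC.
rewrite !QC !LE (dot_sym u0 v0 symQ) (dot_sym u1 v4 symQ) (dot_sym u4 v1 symQ).
rewrite (dot_sym u4 v4 symQ) (dotC u0) (dotC u3) (dotC u5 v3) (dotC u5 v5).
ring.
Qed.

Section LMI.
Variables (R : realType) (n m T : nat) (C : 'rV[R]_n).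

(** This matrix and the next two are the concrete [N], [F] and [D] to which the Finsler lemma is
    applied. *)
Definition sector_mx (Q : 'M[R]_n) : 'M[R]_(n + 1) :=
  block_mx Q (- (2^-1 *: (Q *m C^T))) (- (2^-1 *: (C *m Q))) 1%:M.

Definition gain_mx (Q : 'M[R]_n) (L : 'M[R]_(m, n)) :
    'M[R]_(n + (m + 1), n + 1) :=
  col_mx (row_mx Q 0) (col_mx (row_mx L 0) (row_mx 0 1%:M)).

Definition regressor_mx (U : 'M[R]_(m, T)) (W : 'rV[R]_T)
    (X : 'M[R]_(n, T.+1)) : 'M[R]_(n + (m + 1), T) :=
  col_mx (Xminus X) (col_mx U W).

Lemma dot_sector_mx Q (y : 'cV[R]_n) (c : 'cV[R]_1) : Q^T = Q ->
  dot (col_mx y c) (sector_mx Q *m col_mx y c) =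
  dot y (Q *m y) - dot c (C *m Q *m y) + dot c c.
Proof.
move=> symQ; rewrite /sector_mx mul_block_col dot_col_mx mul1mx !mulNmx.
rewrite -!scalemxAl !dot_linE (dot_mulmxr (Q *m C^T)) trmx_mul trmxK symQ.
by rewrite (dotC _ c); lra.
Qed.

Lemma sector_mx_sym Q : Q^T = Q -> (sector_mx Q)^T = sector_mx Q.
Proof.
move=> symQ; rewrite /sector_mx tr_block_mx !trmxN !trmxZ !trmx_mul.
by rewrite trmxK symQ trmx1.
Qed.

Lemma dot1 (c d : 'cV[R]_1) : dot c d = c 0 0 * d 0 0.
Proof. by rewrite dotE big_ord1. Qed.

Lemma sector_mx_posdef Q : posdefmx Q ->
  posdefmx (sector_mx Q) <-> (C *m Q *m C^T) 0 0 < 4.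
Proof.
move=> posQ; have symQ := posdef_sym posQ.
have CQ y : (C *m Q *m y) 0 0 = dot C^T (Q *m y) by rewrite /dot trmxK mulmxA.
split=> [posN|CQC].
  (* At this vector the form takes the value [4 - C Q C^T]. *)
  have c0 : col_mx C^T 2%:M != 0 :> 'cV[R]_(n + 1).
    rewrite col_mx_eq0 negb_and orbC; apply/orP; left.
    apply/eqP => /colP/(_ 0); rewrite !mxE /= => /eqP.
    by rewrite mulr1n pnatr_eq0.
  have := posdef_gt0 posN c0; rewrite dot_sector_mx // !dot1 CQ !mxE /= -CQ.
  lra.
apply/posdefmxP; split; first exact: sector_mx_sym.
move=> h; rewrite -(vsubmxK h); set y := usubmx h; set c := dsubmx h.
rewrite col_mx_eq0 negb_and dot_sector_mx // !dot1 CQ; set a := c 0 0 => yc0.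
(* Completing the square in [y] leaves the Schur complement [1 - C Q C^T / 4]. *)
have sq : dot y (Q *m y) - a * dot C^T (Q *m y) + a * a =
    dot (y - (a / 2) *: C^T) (Q *m (y - (a / 2) *: C^T)) +
    a ^+ 2 * (1 - dot C^T (Q *m C^T) / 4).
  rewrite mulmxBr -scalemxAr !dot_linE (dot_sym y C^T symQ); lra.
have [a0|a0] := eqVneq a 0.
  rewrite a0 !mul0r subr0 addr0 posdef_gt0 //.
  move: yc0; suff -> : c = 0 by rewrite eqxx orbF.
  by apply/colP => i; rewrite ord1 -/a a0 mxE.
rewrite sq ltr_wpDl ?posdef_ge0 // mulr_gt0 //; first by rewrite exprn_even_gt0.
by move: CQC; rewrite CQ; lra.
Qed.

Lemma gain_mxE (Q A : 'M[R]_n) L (B : 'M[R]_(n, m)) (E : 'cV[R]_n)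
    (y : 'cV[R]_n) (c : 'cV[R]_1) :
  row_mx A (row_mx B E) *m gain_mx Q L *m col_mx y c =
  (A *m Q + B *m L) *m y + E *m c.
Proof.
rewrite -mulmxA !mul_col_mx !mul_row_col !mul0mx !mul1mx !addr0 add0r.
by rewrite mulmxDl !mulmxA addrA.
Qed.

Lemma lmi_finsler_form U W X Q L alpha beta v w1 w2 w3 y c :
  let z := col_mx v (col_mx w1 (col_mx w2 (col_mx w3 (col_mx y c)))) in
  Q^T = Q ->
  dot z ((lmi_mx C Q L beta
          + alpha *: (data_mx U W X *m (data_mx U W X)^T)) *m z) =
  finsler_form Q (sector_mx Q) (gain_mx Q L) (regressor_mx U W X) (Xplus X)
    alpha beta v (col_mx w1 (col_mx w2 w3)) (col_mx y c).
Proof.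
move=> z symQ; rewrite mulmxDl -scalemxAl !dot_linE -mulmxA.
rewrite (dot_mulmxr (data_mx U W X)).
have -> : (data_mx U W X)^T *m z =
    (Xplus X)^T *m v - (regressor_mx U W X)^T *m col_mx w1 (col_mx w2 w3).
  rewrite /z /data_mx /regressor_mx !tr_col_mx !mul_row_col !trmxN !mulNmx.
  by rewrite !trmx0 !mul0mx !addr0 !opprD.
rewrite /finsler_form; congr (_ + _).
rewrite /z /lmi_mx /gain_mx dot_sector_mx //.
rewrite !mul_col_mx !mul_row_col !mul0mx !mul1mx !addr0 !add0r !dot_col_mx.
rewrite mulmxBl mul_scalar_mx !mulNmx -!scalemxAl !dot_linE.
rewrite (dot_mulmxr (Q *m C^T)) trmx_mul trmxK symQ.
rewrite (dot_mulmxr L^T) trmxK.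
rewrite (dot_mulmxr Q y) symQ (dotC (Q *m y)) (dotC (L *m y)).
rewrite (dotC (C *m Q *m y)) (dotC c w3); lra.
Qed.

Definition stab_mx (P M : 'M[R]_n) (E : 'cV[R]_n) : 'M[R]_(n + 1) :=
  block_mx (P - M^T *m P *m M) (- (M^T *m P *m E) - 2^-1 *: C^T)
           (- (E^T *m P *m M) - 2^-1 *: C) (1%:M - E^T *m P *m E).

(** The form is the decrease of [x^T P x] in one step with nonlinearity value [c], plus the sector
    expression [c (c - C x)] with multiplier 1. *)
Lemma dot_stab_mx P M E (x : 'cV[R]_n) (c : 'cV[R]_1) : P^T = P ->
  dot (col_mx x c) (stab_mx P M E *m col_mx x c) =
  dot x (P *m x) - dot c (C *m x) + dot c c
  - dot (M *m x + E *m c) (P *m (M *m x + E *m c)).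
Proof.
move=> symP; rewrite /stab_mx mul_block_col dot_col_mx !mulmxBl !mulNmx mul1mx.
rewrite -!scalemxAl !mulmxDr !dot_linE -!mulmxA.
rewrite !(dot_mulmxr _^T) !trmxK (dotC (C *m x)).
lra.
Qed.

Lemma stab_mx_sym P M E : P^T = P -> (stab_mx P M E)^T = stab_mx P M E.
Proof.
move=> symP; rewrite /stab_mx tr_block_mx !trmxB !trmxN !trmxZ.
by rewrite !trmx_mul !trmxK symP trmx1 !mulmxA.
Qed.
End LMI.

(** * Lyapunov's method and absolute stability *)

Section Stability.
Variables (R : realType) (n : nat).
Implicit Types x : 'cV[R]_n.

(** Stability is stated in the sup norm while the Lyapunov estimates are Euclidean; this and
    [dot_le_sqr_norm] pass between them. *)
Lemma sqr_norm_le_dot x : `|x| ^+ 2 <= dot x x.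
Proof.
have [-> | x0] := eqVneq `|x| 0; first by rewrite expr0n dot_ge0.
have [[i j] /= normE] := mx_norm_neq0 (x0 : mx_norm x != 0).
rewrite (_ : `|x| = `|x i j|); last exact: normE.
by rewrite real_normK ?num_real // ord1 sqr_coord_le_dot.
Qed.

Lemma normr_coord_le x i : `|x i 0| <= `|x|.
Proof.
rewrite [leRHS]/Num.Def.normr /= mx_normrE; apply/bigmax_geP; right => /=.
by exists (i, 0).
Qed.

Lemma dot_le_sqr_norm x : dot x x <= n%:R * `|x| ^+ 2.
Proof.
rewrite dotE mulr_natl -[leRHS](_ : \sum_(i < n) `|x| ^+ 2 = _); last first.
  by rewrite sumr_const card_ord.
apply: ler_sum => i _; rewrite -expr2 -real_normK ?num_real //.
by rewrite lerXn2r ?nnegrE ?normr_coord_le.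
Qed.

(* [x^T P x] contracts by a factor [rho < 1] at each step, and it is comparable
   to [|x|^2]. *)
Lemma lyapunov_geometric (f : 'cV[R]_n -> 'cV[R]_n) (P : 'M[R]_n) c :
  posdefmx P -> 0 < c ->
  (forall x, dot (f x) (P *m f x) <= dot x (P *m x) - c * dot x x) ->
  exists a rho : R, [/\ 0 <= a, 0 <= rho, rho < 1 &
    forall x t, `|iter t f x| ^+ 2 <= a * rho ^+ t * `|x| ^+ 2].
Proof.
move=> posP c0 decr.
have [p p0 P_lower] := posdef_lower posP.
have [q' q'0 P_upper'] := quad_upper P.
(* Enlarging the upper bound by [c] ensures [c / q <= 1], so that [rho >= 0]. *)
pose q := q' + c; have q0 : 0 < q by rewrite addr_gt0.
have P_upper x : dot x (P *m x) <= q * dot x x.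
  by apply: le_trans (P_upper' x) _; rewrite ler_wpM2r ?dot_ge0 // lerDl ltW.
pose rho := 1 - c / q.
have cq1 : c / q <= 1 by rewrite ler_pdivrMr // mul1r lerDr ltW.
have cq0 : 0 < c / q by rewrite divr_gt0.
have rho0 : 0 <= rho by rewrite subr_ge0.
have contract x : dot (f x) (P *m f x) <= rho * dot x (P *m x).
  apply: le_trans (decr x) _; rewrite mulrBl mul1r lerD2l lerN2.
  have := ler_wpM2l (ltW cq0) (P_upper x).
  by rewrite [leRHS]mulrA divfK ?gt_eqF.
have iterP x t :
    dot (iter t f x) (P *m iter t f x) <= rho ^+ t * dot x (P *m x).
  elim: t => [|t IH]; first by rewrite mul1r.
  apply: le_trans (contract _) _; rewrite exprS -mulrA.
  exact: ler_wpM2l.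
exists (p^-1 * q * n%:R), rho; split => //.
- by rewrite !mulr_ge0 ?invr_ge0 // ltW.
- by rewrite /rho; lra.
move=> x t; apply: le_trans (sqr_norm_le_dot _) _.
rewrite -!mulrA ler_pdivlMl //; apply: le_trans (P_lower _) _.
apply: le_trans (iterP x t) _.
have -> : q * (n%:R * (rho ^+ t * `|x| ^+ 2)) =
    rho ^+ t * (q * (n%:R * `|x| ^+ 2)) by ring.
apply: ler_wpM2l; first exact: exprn_ge0.
apply: le_trans (P_upper x) _; rewrite ler_pM2l //.
exact: dot_le_sqr_norm.
Qed.

Lemma lyapunov_gas (f : 'cV[R]_n -> 'cV[R]_n) (P : 'M[R]_n) c :
  posdefmx P -> 0 < c ->
  (forall x, dot (f x) (P *m f x) <= dot x (P *m x) - c * dot x x) -> gas f.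
Proof.
move=> posP c0 /(lyapunov_geometric posP c0)[a [rho [a0 rho0 rho1 decay]]].
split.
  (* Since [rho^t <= 1] and [a <= (1 + a)^2], [|x| (1 + a) < e] suffices; the 1 keeps the
     denominator positive. *)
  move=> e e0; exists (e / (1 + a)); first by rewrite divr_gt0 // ltr_pwDl.
  move=> x xe t; rewrite -(@ltr_pXn2r _ 2) ?nnegrE // ?(ltW e0) //.
  apply: le_lt_trans (decay x t) _.
  have rhot : rho ^+ t <= 1 by rewrite exprn_ile1 // ltW.
  apply: (@le_lt_trans _ _ (a * `|x| ^+ 2)).
    by rewrite ler_wpM2r ?sqr_ge0 // ler_piMr.
  move: xe; rewrite ltr_pdivlMr ?ltr_pwDl // => xe.
  apply: (@le_lt_trans _ _ ((`|x| * (1 + a)) ^+ 2)).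
    by rewrite exprMn mulrC; apply: ler_wpM2l; [exact: sqr_ge0|nra].
  by rewrite ltr_pXn2r ?nnegrE ?mulr_ge0 ?addr_ge0 ?(ltW e0).
move=> x; apply/cvgr0Pnorm_lt => e e0.
have rho_cvg : (a * `|x| ^+ 2 * rho ^+ t @[t --> \oo] --> (0 : R))%classic.
  by apply: cvg_geometric; rewrite ger0_norm.
have e20 : 0 < e ^+ 2 by rewrite exprn_gt0.
move/cvgr0Pnorm_lt/(_ _ e20): rho_cvg; apply: filterS => t.
rewrite ger0_norm; last by rewrite !mulr_ge0 // ?sqr_ge0 ?exprn_ge0.
move=> lt_e; rewrite -(@ltr_pXn2r _ 2) ?nnegrE // ?(ltW e0) //.
by apply: le_lt_trans (decay x t) _; rewrite mulrAC.
Qed.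

(* The S-procedure: [z = phi (C x)] satisfies [z^2 - z C x <= 0]. *)
Lemma stab_mx_absolutely_stable (C : 'rV[R]_n) (P M : 'M[R]_n) (E : 'cV[R]_n) :
  posdefmx P -> posdefmx (stab_mx C P M E) -> absolutely_stable C M E.
Proof.
move=> posP posS phi sector_phi.
have [c c0 S_lower] := posdef_lower posS.
apply: (lyapunov_gas posP c0) => x.
set y := (C *m x) 0 0; set z := phi y.
have zE : (z%:M : 'M[R]_1) 0 0 = z by rewrite mxE mulr1n.
have := S_lower (col_mx x z%:M); rewrite dot_stab_mx ?posdef_sym //.
rewrite mul_mx_scalar dot_col_mx !dot1 !zE -/y.
have := sector_phi y; rewrite -/z.
(* The lower bound [c (|x|^2 + z^2)] is weakened to [c |x|^2]. *)
have := mulr_ge0 (ltW c0) (sqr_ge0 z); lra.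
Qed.
End Stability.

(** * From informativity to the LMI and back *)

Section Informativity.
Variables (R : realType) (n m T : nat) (C : 'rV[R]_n).
Variables (U : 'M[R]_(m, T)) (W : 'rV[R]_T) (X : 'M[R]_(n, T.+1)).

Lemma SigmaE A B E :
  Sigma U W X (A, B, E) <->
  row_mx A (row_mx B E) *m regressor_mx U W X = Xplus X.
Proof.
rewrite /regressor_mx !mul_row_col addrA /Sigma /=.
by split=> ->.
Qed.

(** The congruence by [diag(Q, 1)]: substitute [x = Q y], which is a bijection because [Q P = 1],
    and use [(A + B L P) Q = A Q + B L]. *)
Lemma posdef_stab_mx (Q P A : 'M[R]_n) L (B : 'M[R]_(n, m)) (E : 'cV[R]_n) :
  let Z := row_mx A (row_mx B E) in
  posdefmx P -> Q *m P = 1%:M ->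
  posdefmx (stab_mx C P (A + B *m (L *m P)) E) <->
  forall h, h != 0 ->
    dot (Z *m gain_mx Q L *m h) (P *m (Z *m gain_mx Q L *m h)) <
    dot h (sector_mx C Q *m h).
Proof.
move=> Z posP QP; have symP := posdef_sym posP; have PQ := mulmx1C QP.
have symQ : Q^T = Q.
  by rewrite -[RHS]mulmx1 -trmx1 -QP trmx_mul symP mulmxA QP mul1mx.
have KE : (A + B *m (L *m P)) *m Q = A *m Q + B *m L.
  by rewrite mulmxDl -!mulmxA PQ mulmx1.
have stabE y c :
    dot (col_mx (Q *m y) c)
      (stab_mx C P (A + B *m (L *m P)) E *m col_mx (Q *m y) c) =
    dot (col_mx y c) (sector_mx C Q *m col_mx y c) -
    dot (Z *m gain_mx Q L *m col_mx y c)
      (P *m (Z *m gain_mx Q L *m col_mx y c)).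
  rewrite dot_stab_mx // dot_sector_mx // gain_mxE.
  rewrite [P *m (Q *m y)]mulmxA PQ mul1mx (dotC (Q *m y)) [C *m (Q *m y)]mulmxA.
  by rewrite [(A + _) *m (Q *m y)]mulmxA KE.
split=> [posS h h0|lt_dot].
  rewrite -(vsubmxK h) -subr_gt0 -stabE; apply: posdef_gt0 posS _.
  apply: contra h0; rewrite -[in h == 0](vsubmxK h) !col_mx_eq0.
  case/andP => /eqP Qy ->; rewrite andbT.
  by rewrite -[usubmx h]mul1mx -PQ -mulmxA Qy mulmx0.
apply/posdefmxP; split=> [|h h0]; first exact: stab_mx_sym.
have hE : h = col_mx (Q *m (P *m usubmx h)) (dsubmx h).
  by rewrite mulmxA QP mul1mx vsubmxK.
rewrite hE stabE subr_gt0; apply: lt_dot.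
apply: contra h0; rewrite [in h == 0]hE !col_mx_eq0.
by case/andP => /eqP -> ->; rewrite mulmx0 eqxx.
Qed.

(** Serves both the sufficiency of the LMI and the absolute stability claim. *)
Lemma lmi_solution_stab Q L alpha beta A B E :
  lmi_solution C U W X Q L alpha beta -> Sigma U W X (A, B, E) ->
  posdefmx (stab_mx C (invmx Q) (A + B *m (L *m invmx Q)) E).
Proof.
move=> [posQ beta0 /(sector_mx_posdef _ posQ) posN [_ lmi_ge0]] /SigmaE ZD.
apply/(posdef_stab_mx (Q := Q)) => [||h h0]; first exact: posdef_inv.
  by rewrite mulmxV // posdef_unit.
apply: (finsler_sufficient (alpha := alpha) (beta := beta) posQ _ _ _ ZD) => //.
move=> v w g; rewrite -(vsubmxK w) -(vsubmxK (dsubmx w)) -(vsubmxK g).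
by rewrite -lmi_finsler_form ?posdef_sym // -quad_dot.
Qed.

(** A point of [Sigma] is required as the base point [Z0] of the affine space; over an empty [Sigma]
    informativity would hold vacuously. *)
Lemma informative_lmi_solution :
  (0 < n)%N -> (exists S, Sigma U W X S) ->
  informative_abs_quad_stab C U W X ->
  exists Q L alpha beta, lmi_solution C U W X Q L alpha beta.
Proof.
move=> n0 [[[A0 B0] E0] Sigma0] [P [K [posP stab]]].
pose Q := invmx P; pose L := K *m Q.
have posQ : posdefmx Q by exact: posdef_inv.
have QP : Q *m P = 1%:M by rewrite mulVmx // posdef_unit.
have KE : K = L *m P by rewrite -mulmxA QP mulmx1.
have symN := sector_mx_sym C (posdef_sym posQ).
have stable Z : Z *m regressor_mx U W X = Xplus X ->
    forall h, h != 0 ->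
    dot (Z *m gain_mx Q L *m h) (P *m (Z *m gain_mx Q L *m h)) <
    dot h (sector_mx C Q *m h).
  rewrite -(hsubmxK Z) -(hsubmxK (rsubmx Z)) => /SigmaE /stab.
  by rewrite KE => /(posdef_stab_mx _ _ _ _ posP QP).
have /SigmaE Z0D := Sigma0; have stable0 := stable _ Z0D.
(* At the base point [N] strictly dominates a nonnegative term, hence [N > 0]. *)
have CQC : (C *m Q *m C^T) 0 0 < 4.
  apply/(sector_mx_posdef _ posQ)/posdefmxP; split=> // h h0.
  exact: le_lt_trans (posdef_ge0 _ posP) (stable0 h h0).
rewrite -Z0D in stable.
have [alpha [beta [beta0 form_ge0]]] :=
  finsler_necessary posQ QP stable n0 symN.
exists Q, L, alpha, beta; split=> //; split.
  by rewrite linearD linearZ /= trmx_mul trmxK lmi_mx_sym // posdef_sym.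
move=> z; rewrite quad_dot -(vsubmxK z) -(vsubmxK (dsubmx z)).
set z1 := dsubmx (dsubmx z); rewrite -(vsubmxK z1) -(vsubmxK (dsubmx z1)).
set z2 := dsubmx (dsubmx z1); rewrite -(vsubmxK z2).
by rewrite lmi_finsler_form ?posdef_sym // -Z0D.
Qed.

End Informativity.

Theorem theorem3 (R : realType) (n m T : nat)
    (n_ge1 : (1 <= n)%N) (m_ge1 : (1 <= m)%N) (T_ge1 : (1 <= T)%N)
    (C : 'rV[R]_n)
    (As : 'M[R]_n) (Bs : 'M[R]_(n, m)) (Es : 'cV[R]_n)
    (phi : R -> R) (phi_sector : sector phi)
    (x : nat -> 'cV[R]_n) (u : nat -> 'cV[R]_m)
    (x_dyn : forall t : nat, (t < T)%N ->
       x t.+1 = As *m x t + Bs *m u t + phi ((C *m x t) 0 0) *: Es)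
    (X : 'M[R]_(n, T.+1)) (X_def : X = columns T.+1 x)
    (U : 'M[R]_(m, T)) (U_def : U = columns T u)
    (W : 'rV[R]_T) (W_def : W = \row_(t < T) phi ((C *m x t) 0 0)) :
  (informative_abs_quad_stab C U W X <->
   exists (Q : 'M[R]_n) (L : 'M[R]_(m, n)) (alpha beta : R),
     lmi_solution C U W X Q L alpha beta)
  /\
  (forall (Q : 'M[R]_n) (L : 'M[R]_(m, n)) (alpha beta : R),
     lmi_solution C U W X Q L alpha beta ->
     let K := L *m invmx Q in
     forall (A : 'M[R]_n) (B : 'M[R]_(n, m)) (E : 'cV[R]_n),
       Sigma U W X (A, B, E) ->
       absolutely_stable C (A + B *m K) E).
Proof.
split; first split=> [info|[Q [L [alpha [beta sol]]]]].
(* The system that generated the data is a point of [Sigma]. *)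
- apply: informative_lmi_solution => //; exists (As, Bs, Es).
  rewrite /Sigma /= X_def U_def W_def; apply/matrixP => i t.
  rewrite mxE mxE /= x_dyn ?ltn_ord // !mxE big_ord1.
  congr (_ + _ + _); last by rewrite !mxE mulrC.
    by apply: eq_bigr => j _; rewrite !mxE.
  by apply: eq_bigr => j _; rewrite !mxE.
- exists (invmx Q), (L *m invmx Q); have [posQ _ _ _] := sol.
  split=> [|A B E Sigma_ABE]; first exact: posdef_inv.
  exact: lmi_solution_stab sol Sigma_ABE.
move=> Q L alpha beta sol K A B E Sigma_ABE; have [posQ _ _ _] := sol.
apply: stab_mx_absolutely_stable (posdef_inv posQ) _.
exact: lmi_solution_stab sol Sigma_ABE.
Qed.
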